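(* Let $\alpha,\beta$ be real numbers with $\sin(\alpha)=\tan\left(\frac{\beta}{2}\right)$. Then $$Cl_{2}(\pi-2\beta)-2Cl_{2}(\beta)-2Cl_{2}(\pi-\beta)+2Cl_{2}(\alpha)+2Cl_{2}(\pi-\alpha)+2Cl_{2}(\beta-\alpha)-2Cl_{2}(\pi-\alpha-\beta)=0.$$
   Context: $Cl_2$ denotes the Clausen function on $\mathbb{R}$: $Cl_{2}(x)=-\int_{0}^{x}\log\left(2\left|\sin\frac{\varphi}{2}\right|\right)d\varphi=\sum_{n=1}^{\infty}\frac{\sin(nx)}{n^{2}}$. *)

(* Defs.v *)
From mathcomp Require Import all_boot all_order all_algebra.
From mathcomp Require Import all_classical all_reals all_analysis.

Set Implicit Arguments.
Unset Strict Implicit.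
Unset Printing Implicit Defensive.

Import Order.TTheory GRing.Theory Num.Theory.
Import numFieldNormedType.Exports.

Local Open Scope classical_set_scope.
Local Open Scope ring_scope.

(* The integrand -log(2 |sin (phi / 2)|) is unbounded at 0 and at the other
   multiples of 2 pi, but Lebesgue integrable on bounded intervals. At these
   points the library sets ln 0 = 0, which affects only a null set. The integral
   from 0 to x is oriented: for x < 0 it is minus the integral over [x, 0]. *)
Definition Cl2 (R : realType) (x : R) : R :=
  let f (phi : R) : R := ln (2 * `|sin (phi / 2)|) in
  if 0 <= x then - (\int[lebesgue_measure]_(phi in `[0, x]) f phi)
  else \int[lebesgue_measure]_(phi in `[x, 0]) f phi.

(* Main.v *)
Require Import Defs.
From mathcomp Require Import all_boot all_order all_algebra.
From mathcomp Require Import all_classical all_reals all_analysis.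
From mathcomp Require Import measurable_realfun ring lra.
Import Order.TTheory GRing.Theory Num.Theory.
Import numFieldNormedType.Exports.

Set Implicit Arguments.
Unset Strict Implicit.
Unset Printing Implicit Defensive.
Local Open Scope classical_set_scope.
Local Open Scope ring_scope.

(* Write L(x) = ln (2 |sin (x/2)|), so that Cl2' = - L off 2 pi Z. Along the
   branch beta = 2 atan (sin alpha), every sine occurring in the derivative of
   the left-hand side factors through sin (alpha/2), cos (alpha/2),
   cos (beta/2) and cos alpha, and the logarithms cancel wherever
   sin (2 alpha) != 0. The left-hand side is continuous, hence constant, and it
   vanishes at alpha = 0 because Cl2 pi = 0. The other branches differ by
   multiples of 2 pi in beta, a period of Cl2. Oddness, periodicity and
   Cl2 pi = 0 (from the duplication L(2x) = L(x) + L(pi - x)) follow from the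
   same constancy principle. *)

(** * Differentiation rules for real functions of one variable *)

Section pointwise_derivatives.
Context {R : realType}.
Implicit Types (f g : R -> R) (x a b c : R).

(** The rules are restated with explicit lambdas instead of operations on functions, so that the
    derivative of a concrete expression can be assembled as a single term. *)
Lemma is_derive1D f g x a b : is_derive x 1 f a -> is_derive x 1 g b ->
  is_derive x 1 (fun y => f y + g y) (a + b).
Proof. exact: is_deriveD. Qed.

Lemma is_derive1B f g x a b : is_derive x 1 f a -> is_derive x 1 g b ->
  is_derive x 1 (fun y => f y - g y) (a - b).
Proof. exact: is_deriveB. Qed.

Lemma is_derive1M f g x a b : is_derive x 1 f a -> is_derive x 1 g b ->
  is_derive x 1 (fun y => f y * g y) (f x * b + g x * a).
Proof. exact: is_deriveM. Qed.

Lemma is_derive1Z f x a c : is_derive x 1 f a ->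
  is_derive x 1 (fun y => c * f y) (c * a).
Proof. exact: is_deriveZ. Qed.

Lemma is_derive1_comp_fun g f x a b : is_derive x 1 f a ->
  is_derive (f x) 1 g b -> is_derive x 1 (fun y => g (f y)) (b * a).
Proof. by move=> fa gb; exact: (is_derive1_comp gb fa). Qed.

Lemma is_derive1_cst c x : is_derive x 1 (fun=> c) 0.
Proof. exact: is_derive_cst. Qed.

Lemma is_derive1_id x : is_derive x 1 (fun y => y) 1.
Proof. exact: is_derive_id. Qed.

Lemma is_derive1_continuous f x a : is_derive x 1 f a -> {for x, continuous f}.
Proof.
by move=> [fx _]; exact/differentiable_continuous/derivable1_diffP.
Qed.

End pointwise_derivatives.

(** * Integrability of the logarithmic integrand on bounded intervals *)

Section lsin.
Context {R : realType}.
Notation mu := (@lebesgue_measure R).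

Definition lsin (x : R) : R := ln (2 * `|sin (x / 2)|).

(* [g e] regularizes [1 - ln |sin (x / 2)|]. Up to a linear term, [H e] comes
   from [- sin (x / 2) cos (x / 2) ln (sin (x / 2) ^+ 2)], whose derivative is
   [- ln |sin (x / 2)|] plus a bounded function; so [dH e] dominates [g e], and
   the integrals of [g e] stay bounded as [e] tends to 0. *)
Let v (e x : R) : R := sin (x / 2) ^+ 2 + e.
Let g (e x : R) : R := 1 - 2^-1 * ln (v e x).
Let H (e x : R) : R := 3 * x - sin (x / 2) * cos (x / 2) * ln (v e x).
Let dH (e x : R) : R :=
  3 - 2^-1 * (cos (x / 2) ^+ 2 - sin (x / 2) ^+ 2) * ln (v e x)
  - (sin (x / 2) * cos (x / 2)) ^+ 2 / v e x.

Let v_gt0 (e x : R) : 0 < e -> 0 < v e x.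
Proof. by move=> e0; rewrite ltr_wpDl// sqr_ge0. Qed.

Let sin2_le1 (x : R) : sin x ^+ 2 <= 1.
Proof. by rewrite sin2cos2 gerBl sqr_ge0. Qed.

Let cos2_le1 (x : R) : cos x ^+ 2 <= 1.
Proof. by rewrite cos2sin2 gerBl sqr_ge0. Qed.

Let is_derive_half (x : R) : is_derive x 1 (fun y : R => y / 2) (2^-1).
Proof.
have := is_derive1M (is_derive1_id x) (is_derive1_cst 2^-1 x).
by rewrite mulr0 add0r mulr1.
Qed.

Let is_derive_sin_half (x : R) :
  is_derive x 1 (fun y : R => sin (y / 2)) (cos (x / 2) / 2).
Proof. exact: is_derive1_comp_fun (is_derive_half x) (is_derive_sin _). Qed.

Let is_derive_cos_half (x : R) :
  is_derive x 1 (fun y : R => cos (y / 2)) (- sin (x / 2) / 2).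
Proof. exact: is_derive1_comp_fun (is_derive_half x) (is_derive_cos _). Qed.

Let is_derive_v (e x : R) : is_derive x 1 (v e) (sin (x / 2) * cos (x / 2)).
Proof.
have sh := is_derive_sin_half x.
have h := is_derive1D (is_derive1M sh sh) (is_derive1_cst e x).
by apply: (is_derive_eq h); field.
Qed.

Let is_derive_lnv (e x : R) : 0 < e ->
  is_derive x 1 (fun y => ln (v e y))
    ((v e x)^-1 * (sin (x / 2) * cos (x / 2))).
Proof.
move=> e0.
exact: is_derive1_comp_fun (is_derive_v e x) (is_derive1_ln (v_gt0 x e0)).
Qed.

Let is_derive_H (e x : R) : 0 < e -> is_derive x 1 (H e) (dH e x).
Proof.
move=> e0.
have h := is_derive1B (is_derive1Z 3 (is_derive1_id x)) 
  (is_derive1M (is_derive1M (is_derive_sin_half x) (is_derive_cos_half x))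
    (is_derive_lnv x e0)).
apply: (is_derive_eq h); rewrite /dH.
by field; rewrite gt_eqF ?v_gt0.
Qed.

Let continuous_dH (e : R) : 0 < e -> continuous (dH e).
Proof.
move=> e0 x.
have cs := is_derive1_continuous (is_derive_sin_half x).
have cc := is_derive1_continuous (is_derive_cos_half x).
have cl := is_derive1_continuous (is_derive_lnv x e0).
have cv := is_derive1_continuous (is_derive_v e x).
apply: (@continuousB _ R^o R _ _ x); last first.
  apply: continuousM; last by apply: continuousV => //; rewrite gt_eqF// v_gt0.
  exact: continuousM (continuousM cs cc) (continuousM cs cc).
apply: (@continuousB _ R^o R _ _ x); first exact: cvg_cst.
apply: continuousM => //; apply: continuousM; first exact: cvg_cst.
apply: (@continuousB _ R^o R _ _ x).
  exact: (continuousM cc cc).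
exact: (continuousM cs cs).
Qed.

Let continuous_g (e : R) : 0 < e -> continuous (g e).
Proof.
move=> e0 x; apply: (@continuousB _ R^o R _ _ x); first exact: cvg_cst.
apply: continuousM; first exact: cvg_cst.
exact: is_derive1_continuous (is_derive_lnv x e0).
Qed.

(** With s = sin (x/2) ^ 2, the difference [dH e x - g e x] equals 2 + s ln v - A, where A is the
    last quotient in [dH]. Since - ln v <= 1/v and s <= v, both - s ln v and A are at most 1. *)
Let g_le_dH (e x : R) : 0 < e -> g e x <= dH e x.
Proof.
move=> e0; rewrite /g /dH.
have v0 := v_gt0 x e0.
have l : - ln (v e x) <= (v e x)^-1.
  by rewrite -lnV ?posrE// ltW// ln_sublinear// invr_gt0.
have s1 : sin (x / 2) ^+ 2 / v e x <= 1.
  by rewrite ler_pdivrMr// mul1r /v lerDl ltW.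
have : sin (x / 2) ^+ 2 * - ln (v e x) <= 1.
  by apply: le_trans s1; rewrite ler_wpM2l// sqr_ge0.
have : (sin (x / 2) * cos (x / 2)) ^+ 2 / v e x <= 1.
  apply: le_trans s1; apply: ler_wpM2r; first by rewrite invr_ge0 ltW.
  by rewrite exprMn ler_piMr ?sqr_ge0.
rewrite cos2sin2; set A := _ / v e x; move: (sin (x / 2) ^+ 2) => s ? ?.
lra.
Qed.

Let ln2_le1 : ln (2 : R) <= 1.
Proof. by apply: (@le_ln1Dx R 1); rewrite (lt_trans _ ltr01)// ltrN10. Qed.

Let g_ge0 (e x : R) : 0 < e <= 1 -> 0 <= g e x.
Proof.
move=> /andP[e0 e1]; rewrite /g.
have : ln (v e x) <= ln 2.
  by rewrite ler_ln ?posrE ?v_gt0// /v -[leRHS]natr1 lerD.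
by move: ln2_le1; lra.
Qed.

Let measurable_EFin_cont (f : R -> R) (D : set R) :
  continuous f -> measurable_fun D (fun x => (f x)%:E).
Proof.
move=> cf; apply/measurable_EFinP/measurable_funTS.
exact: continuous_measurable_fun.
Qed.

(** The condition sin (N/2) = 0 kills the logarithmic term of [H e] at both endpoints. Only the
    linear term survives, so the bound is independent of [e]. *)
Let int_g_le (e N : R) : 0 < e <= 1 -> 0 < N -> sin (N / 2) = 0 ->
  (\int[mu]_(x in `[(- N)%R, N]) (g e x)%:E <= (6 * N)%:E)%E.
Proof.
move=> /andP[e0 e1] N0 sN.
have NN : - N < N by lra.
have dH_H (x : R) : is_derive x 1 (H e) (dH e x) by exact: is_derive_H.
have -> : 6 * N = H e N - H e (- N).
  by rewrite /H mulNr sinN sN oppr0 !mul0r !subr0; ring.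
rewrite EFinB -(@continuous_FTC2 _ (dH e) (H e) (- N) N) //.
- apply: ge0_le_integral => //=.
  + by move=> x _; rewrite lee_fin g_ge0// e0.
  + by apply: measurable_EFin_cont; exact: continuous_g.
  + by apply: measurable_EFin_cont; exact: continuous_dH.
  + by move=> x _; rewrite lee_fin g_le_dH.
- by apply: continuous_subspaceT; exact: continuous_dH.
- split.
  + by move=> x _; case: (dH_H x).
  + apply: cvg_at_right_filter; exact: is_derive1_continuous (dH_H _).
  + apply: cvg_at_left_filter; exact: is_derive1_continuous (dH_H _).
- by move=> x _; rewrite derive1E; case: (dH_H x).
Qed.

Lemma continuous_norm_sin_half : continuous (fun x : R => 2 * `|sin (x / 2)|).
Proof.
move=> x; apply: (@continuousM R R (cst 2) (fun x : R => `|sin (x / 2)|)).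
  exact: cvg_cst.
apply: (@continuous_comp _ _ _ (fun y : R => sin (y / 2)) Num.norm).
  exact: is_derive1_continuous (is_derive_sin_half x).
exact: norm_continuous.
Qed.

Lemma measurable_lsin : measurable_fun [set: R] lsin.
Proof.
have m := continuous_measurable_fun continuous_norm_sin_half.
exact: (measurableT_comp (@measurable_ln R) m).
Qed.

Let eps (n : nat) : R := n.+1%:R^-1.

Let eps01 n : 0 < eps n <= 1.
Proof. by rewrite invr_gt0 ltr0n /= invf_le1 ?ltr0n// ler1n. Qed.

(** Away from the zeros of sin (x/2), the regularizations tend to 1 - ln |sin (x/2)|. This dominates
    |ln 2 + ln |sin (x/2)|| because 0 <= ln 2 <= 1 and ln |sin (x/2)| <= 0. *)
Let lsin_le_liminf x :
  (`|lsin x|%:E <= limn_einf (fun n => (g (eps n) x)%:E))%E.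
Proof.
have [s0|s0] := eqVneq (sin (x / 2)) 0.
  (* At a zero of the sine the convention ln 0 = 0 makes the left side 0, so nonnegativity of the
     [g (eps n) x] is enough. *)
  rewrite /lsin s0 normr0 mulr0 ln0// normr0.
  rewrite limn_einf_lim; apply: lime_ge; first exact: is_cvg_einfs.
  apply: nearW => n; apply: le_ereal_inf_tmp => _ [m _ <-].
  by rewrite lee_fin g_ge0.
have cg : (fun n => (g (eps n) x)%:E) @ \oo --> (1 - ln `|sin (x / 2)|)%:E.
  apply: cvg_EFin; first exact: nearW.
  apply: cvgB; first exact: cvg_cst.
  rewrite (_ : ln `|_| = 2^-1 * ln (sin (x / 2) ^+ 2)); last first.
    rewrite -(ger0_norm (sqr_ge0 (sin (x / 2)))) normrX lnXn ?normr_gt0//.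
    by rewrite -mulr_natl; field.
  apply: cvgM; first exact: cvg_cst.
  apply: continuous_cvg; first by apply: continuous_ln; rewrite exprn_even_gt0.
  rewrite -[X in _ --> X]addr0; apply: cvgD; first exact: cvg_cst.
  exact: cvg_harmonic.
rewrite (cvg_limn_einf_sup cg).1 lee_fin /lsin lnM ?posrE ?normr_gt0//.
have := ln2_le1; have : 0 <= ln (2 : R) by rewrite ln_ge0// ler1n.
have : ln `|sin (x / 2)| <= 0 by rewrite ln_le0// sin_max.
by move=> ? ? ?; rewrite ler_norml; lra.
Qed.

Lemma integrable_lsin (a b : R) : mu.-integrable `[a, b] (EFin \o lsin).
Proof.
pose n := Num.truncn (Num.max `|a| `|b|).
(* A multiple of 2 pi, so that sin (N/2) = 0, and large enough that [-N, N] contains [a, b]. *)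
pose N : R := n.+1%:R * (2 * pi).
have nN : n.+1%:R <= N.
  by rewrite /N ler_peMr//; have := @pi_ge2 R; lra.
have N0 : 0 < N by rewrite !mulr_gt0 ?pi_gt0.
have sN : sin (N / 2) = 0.
  have -> : N / 2 = 0 + pi *+ n.+1 by rewrite add0r -mulr_natl /N; field.
  by rewrite (alternatingn (@sinDpi R)) sin0 mulr0.
have abN : Num.max `|a| `|b| <= N.
  by apply: le_trans nN; rewrite ltW// truncnS_gt.
apply: (@integrableS _ _ _ mu `[- N, N]) => //.
  apply: subset_itv; rewrite bnd_simp.
    by rewrite lerNl (le_trans _ abN)// le_max -normrN ler_norm.
  by rewrite (le_trans _ abN)// le_max ler_norm orbT.
apply/integrableP; split.
  by apply/measurable_EFinP/measurable_funTS; exact: measurable_lsin.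
(* Fatou's lemma transfers the uniform bound 6 N to the lower limit, which dominates |[lsin]|. *)
have fat : (\int[mu]_(x in `[(- N)%R, N]) limn_einf (fun n => (g (eps n) x)%:E)
    <= (6 * N)%:E)%E.
  apply: le_trans (fatou _ _ _ _) _ => //.
  - move=> k; apply: measurable_EFin_cont.
    by apply: continuous_g; case/andP: (eps01 k).
  - by move=> k x _; rewrite lee_fin g_ge0.
  - rewrite limn_einf_lim; apply: lime_le; first exact: is_cvg_einfs.
    apply: nearW => k; apply: (le_trans (ereal_inf_lbound _)).
      by exists k => /=.
    exact: int_g_le.
apply: (le_lt_trans _ (ltry (6 * N))); apply: (le_trans _ fat).
apply: ge0_le_integral => //=.
- apply/measurable_EFinP/measurableT_comp => //.
  by apply: measurable_funTS; exact: measurable_lsin.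
(* The lower limit unfolds to the opposite of the upper limit of the opposites, whose measurability
   is known. *)
- apply: (@measurableT_comp _ _ _ _ _ _ (-%E)) => //.
  apply: measurable_fun_limn_esup => k; apply: measurableT_comp => //.
  by apply: measurable_EFin_cont; apply: continuous_g; case/andP: (eps01 k).
Qed.

End lsin.

(** * The constancy principle off the zeros of sin (2x) *)

Section constancy.
Context {R : realType}.

(** The exceptional points are the multiples of pi/2. On each interval between consecutive ones the
    mean value theorem needs the derivative only in the interior, and continuity glues the intervals
    by induction. Negative arguments follow by reflection. *)
Lemma derive0_off_sin2_eq0_cst (H : R -> R) : continuous H ->
  (forall x, sin (2 * x) != 0 -> is_derive x 1 H 0) -> forall x, H x = H 0.
Proof.
wlog suff pos : H / continuous H ->
    (forall x : R, sin (2 * x) != 0 -> is_derive x 1 H 0) ->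
    forall x, 0 <= x -> H x = H 0.
  move=> cH dH x; have [x0|x0] := leP 0 x; first exact: pos.
  have := pos (fun y => H (- y)) _ _ (- x).
  rewrite /= opprK oppr0; apply; last by lra.
  - by move=> y; apply: continuous_comp; [exact: opp_continuous|exact: cH].
  - move=> y sy.
    have h : is_derive (- y) 1 H 0.
      by apply: dH; rewrite mulrN sinN oppr_eq0.
    have hN : is_derive y 1 (fun z : R => - z) (-1) by exact: is_deriveNid.
    have := is_derive1_comp_fun hN h.
    by rewrite mul0r.
move=> cH dH x x0.
suff main (n : nat) y : 0 <= y <= n%:R * (pi / 2) -> H y = H 0.
  apply: (main (Num.truncn x).+1); rewrite x0 /=.
  have /ltW xn : x < (Num.truncn x).+1%:R by exact: truncnS_gt.
  apply: (le_trans xn); rewrite ler_peMr//; exact: pihalf_ge1.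
elim: n y => [|n IH] y /andP[y0 yn].
  by congr H; apply/eqP; rewrite eq_le y0 andbT (le_trans yn)// mul0r.
have [ynn|ynn] := leP y (n%:R * (pi / 2)); first by apply: IH; rewrite y0.
rewrite -(IH (n%:R * (pi / 2))); last first.
  by rewrite lexx andbT mulr_ge0// divr_ge0// pi_ge0.
have dH0 z : z \in `]n%:R * (pi / 2), y[%R -> is_derive z 1 H ((fun=> 0) z).
  rewrite in_itv /= => /andP[nz zy]; apply: dH.
  (* Shifting by n pi changes the sine only by a sign and brings the argument into ]0, pi[. *)
  have -> : 2 * z = (2 * z - n%:R * pi) + pi *+ n.
    by rewrite -[pi *+ n]mulr_natl subrK.
  rewrite (alternatingn (@sinDpi R)) mulf_neq0 ?signr_eq0//.
  rewrite gt_eqF// sin_gt0_pi//.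
  have := lt_le_trans zy yn; rewrite -natr1 => h.
  by apply/andP; split; lra.
have [|c _] := MVT ynn dH0; first exact: continuous_subspaceT.
by rewrite mul0r => /eqP; rewrite subr_eq0 => /eqP.
Qed.

End constancy.

(** * Continuity and derivative of the Clausen function *)

Section Clausen.
Context {R : realType}.
Notation mu := (@lebesgue_measure R).

Let P (a x : R) : R := \int[mu]_(t in `[a, x]) lsin t.

(** A base point below both 0 and x merges the two orientations of the integral into one formula, to
    which results on indefinite integrals apply. *)
Let Cl2E (a x : R) : a < 0 -> a <= x -> Cl2 x = P a 0 - P a x.
Proof.
move=> a0 ax; rewrite /Cl2 /P -/lsin; case: ifPn => [x0|].
  rewrite -[RHS]opprB; congr (- _).
  rewrite Rintegral_itvB; last 3 first.
  - exact: integrable_lsin.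
  - by rewrite bnd_simp ltW.
  - by rewrite bnd_simp.
  rewrite Rintegral_itv_obnd_cbnd//.
  apply: integrableS (integrable_lsin 0 x) => //.
  by apply: subset_itvr; rewrite bnd_simp.
rewrite -ltNge => x0; rewrite Rintegral_itvB; last 3 first.
- exact: integrable_lsin.
- by rewrite bnd_simp.
- by rewrite bnd_simp ltW.
rewrite Rintegral_itv_obnd_cbnd//.
apply: integrableS (integrable_lsin x 0) => //.
by apply: subset_itvr; rewrite bnd_simp.
Qed.

(** The base point -|x| - 1 lies strictly below 0 and x, hence below all points near x. *)
Let near_Cl2 (x : R) : let a : R := - `|x| - 1 in
  \forall y \near x, P a 0 - P a y = Cl2 y.
Proof.
move=> a.
have ax : a < x by have := ler_norm (- x); rewrite normrN /a; lra.
have a0 : a < 0 by have := normr_ge0 x; rewrite /a; lra.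
apply: filterS (lt_nbhsr ax) => y /ltW ay.
by rewrite (Cl2E a0 ay).
Qed.

Let bounds (x : R) : (- `|x| - 1 < x) * (x < `|x| + 1).
Proof.
by have := ler_norm x; have := ler_norm (- x); rewrite normrN; split; lra.
Qed.

(** An indefinite integral of an integrable function is continuous, so continuity also holds at the
    logarithmic singularities. *)
Lemma continuous_Cl2 : continuous (@Cl2 R).
Proof.
move=> x; have [ax xb] := bounds x.
have ab := lt_trans ax xb.
have cP : {for x, continuous (P (- `|x| - 1))}.
  apply: (within_continuous_continuous ab); last by rewrite in_itv /= ax xb.
  exact: (parameterized_integral_continuous (ltW ab) (integrable_lsin _ _)).
have h : {for x, continuous (fun y => P (- `|x| - 1) 0 - P (- `|x| - 1) y)}.
  by apply: (@continuousB _ R^o R _ _ x) => //; exact: cvg_cst.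
rewrite /continuous_at -(nbhs_singleton (near_Cl2 x)).
by apply: cvg_trans h; apply: near_eq_cvg; apply: filterS (near_Cl2 x).
Qed.

(** Where sin (x/2) does not vanish the integrand is continuous, so the fundamental theorem of
    calculus applies. *)
Lemma is_derive_Cl2 (x : R) : sin (x / 2) != 0 ->
  is_derive x 1 (@Cl2 R) (- lsin x).
Proof.
move=> s0; have [ax xb] := bounds x.
apply: near_eq_is_derive (near_Cl2 x) _.
have cl : {for x, continuous (@lsin R)}.
  apply: continuous_comp; first exact: continuous_norm_sin_half.
  by apply: continuous_ln; rewrite mulr_gt0// normr_gt0.
have [d1 d2] := continuous_FTC1_closed xb (integrable_lsin _ _) ax cl.
have dP : is_derive x 1 (P (- `|x| - 1)) (lsin x).
  by apply: DeriveDef => //; rewrite -derive1E.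
apply: (is_derive_eq (is_derive1B (is_derive1_cst _ x) dP)).
by rewrite sub0r.
Qed.

End Clausen.

(** * Oddness, duplication and periodicity of the Clausen function *)

Lemma periodic_int (U V : zmodType) (f : U -> V) (T : U) :
  periodic f T -> forall (m : int) x, f (x + T *~ m) = f x.
Proof.
move=> fT [n|n] x; first exact: periodicn.
by rewrite -[in RHS](subrK (T *+ n.+1) x) (periodicn fT) NegzE mulrNz.
Qed.

Section Clausen_identities.
Context {R : realType}.
Implicit Types (x s c : R) (f : R -> R).

Lemma lsinE x s : sin (x / 2) = s -> lsin x = ln (2 * `|s|).
Proof. by rewrite /lsin => ->. Qed.

Lemma ln_normM (a b : R) : a != 0 -> b != 0 -> ln `|a * b| = ln `|a| + ln `|b|.
Proof. by move=> a0 b0; rewrite normrM lnM// posrE normr_gt0. Qed.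

Lemma ln2_normE (a : R) : a != 0 -> ln (2 * `|a|) = ln 2 + ln `|a|.
Proof. by move=> a0; rewrite lnM// posrE ?normr_gt0. Qed.

Lemma lsinN x : lsin (- x) = lsin x.
Proof. by rewrite /lsin mulNr sinN normrN. Qed.

Lemma lsinD2pi x : lsin (x + 2 * pi) = lsin x.
Proof.
rewrite /lsin (_ : (x + 2 * pi) / 2 = x / 2 + pi); last by field.
by rewrite sinDpi normrN.
Qed.

Lemma sin_half_piB x : sin ((pi - x) / 2) = cos (x / 2).
Proof.
rewrite (_ : (pi - x) / 2 = - (x / 2 - pi / 2)); last by field.
by rewrite sinN sinBpihalf opprK.
Qed.

Lemma sin_double x : sin x = 2 * (sin (x / 2) * cos (x / 2)).
Proof.
rewrite [in LHS](_ : x = (x / 2) *+ 2); last by rewrite -mulr_natl; field.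
by rewrite sin_mulr2n; ring.
Qed.

Lemma sin_half_neq0 x : sin x != 0 -> sin (x / 2) != 0 /\ cos (x / 2) != 0.
Proof.
by rewrite sin_double !mulf_eq0 pnatr_eq0 /= negb_or => /andP.
Qed.

Lemma is_derive_Cl2_comp f x (a : R) : is_derive x 1 f a ->
  sin (f x / 2) != 0 -> is_derive x 1 (fun y => Cl2 (f y)) (- a * lsin (f x)).
Proof.
move=> fa s0; apply: (is_derive_eq (is_derive1_comp_fun fa (is_derive_Cl2 s0))).
by ring.
Qed.

Lemma continuous_Cl2_comp f : continuous f -> continuous (fun y => Cl2 (f y)).
Proof.
move=> cf x; apply: (@continuous_comp _ _ _ f (@Cl2 R)); first exact: cf.
exact: continuous_Cl2.
Qed.

Lemma is_derive_affine (a b x : R) : is_derive x 1 (fun y => a + b * y) b.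
Proof.
have := is_derive1D (is_derive1_cst a x) (is_derive1Z b (is_derive1_id x)).
by rewrite add0r mulr1.
Qed.

Lemma continuous_affine (a b : R) : continuous (fun y => a + b * y).
Proof. by move=> x; exact: is_derive1_continuous (is_derive_affine a b x). Qed.

Lemma continuous1D f (g : R -> R) : continuous f -> continuous g ->
  continuous (fun y => f y + g y).
Proof. by move=> cf cg x; apply: cvgD; [exact: cf|exact: cg]. Qed.

Lemma continuous1Z f c : continuous f -> continuous (fun y => c * f y).
Proof. by move=> cf x; apply: cvgM; [exact: cvg_cst|exact: cf]. Qed.

Lemma Cl2_0 : Cl2 0 = 0 :> R.
Proof. by rewrite /Cl2 lexx set_itv1 Rintegral_set1 oppr0. Qed.

(** Since [lsin] is even, Cl2 (-y) + Cl2 y has derivative 0 off the exceptional points, and it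
    vanishes at 0. *)
Lemma Cl2N x : Cl2 (- x) = - Cl2 x.
Proof.
pose H y := Cl2 (0 + -1 * y) + Cl2 y : R.
have cH : continuous H.
  apply: continuous1D; last exact: continuous_Cl2.
  exact/continuous_Cl2_comp/continuous_affine.
have dH (y : R) : sin (2 * y) != 0 -> is_derive y 1 H 0.
  (* In this form the half-angle lemma applies twice: sin (2y) != 0 gives sin y != 0, then sin (y/2)
     != 0. *)
  have -> : 2 * y = y * 2 by rewrite mulrC.
  move=> /sin_half_neq0; rewrite mulfK// => -[/sin_half_neq0[s c] _].
  apply: (is_derive_eq (is_derive1D
    (is_derive_Cl2_comp (is_derive_affine 0 (-1) y) _) (is_derive_Cl2 s))).
    by rewrite add0r mulN1r mulNr sinN oppr_eq0.
  by rewrite add0r mulN1r lsinN; ring.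
have := derive0_off_sin2_eq0_cst cH dH x.
rewrite /H mulr0 addr0 Cl2_0 addr0 add0r mulN1r.
by move/eqP; rewrite addr_eq0 => /eqP.
Qed.

(** The 2 pi-periodicity of [lsin] gives periodicity only up to the constant Cl2 (2 pi), whose
    vanishing is deduced later from Cl2 pi = 0. *)
Lemma Cl2D2pi_cst x : Cl2 (x + 2 * pi) = Cl2 x + Cl2 (2 * pi).
Proof.
pose H y := Cl2 (2 * pi + 1 * y) + -1 * Cl2 y : R.
have cH : continuous H.
  apply: continuous1D; last exact/continuous1Z/continuous_Cl2.
  exact/continuous_Cl2_comp/continuous_affine.
have dH (y : R) : sin (2 * y) != 0 -> is_derive y 1 H 0.
  have -> : 2 * y = y * 2 by rewrite mulrC.
  move=> /sin_half_neq0; rewrite mulfK// => -[/sin_half_neq0[s c] _].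
  apply: (is_derive_eq (is_derive1D
    (is_derive_Cl2_comp (is_derive_affine (2 * pi) 1 y) _)
    (is_derive1Z (-1) (is_derive_Cl2 s)))).
    rewrite mul1r (_ : (2 * pi + y) / 2 = y / 2 + pi); last by field.
    by rewrite sinDpi oppr_eq0.
  by rewrite mul1r addrC addrC (addrC (2 * pi)) lsinD2pi; ring.
have := derive0_off_sin2_eq0_cst cH dH x.
rewrite /H mulr0 addr0 Cl2_0 mulr0 addr0 mul1r addrC => <-.
by rewrite [2 * pi + x]addrC; ring.
Qed.

Lemma lsin_double x : sin x != 0 -> lsin (2 * x) = lsin x + lsin (pi - x).
Proof.
move=> s0; have [sh ch] := sin_half_neq0 s0.
rewrite (@lsinE (2 * x) (sin x)); last by congr sin; field.
rewrite (@lsinE (pi - x) (cos (x / 2))); last exact: sin_half_piB.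
rewrite /lsin sin_double normrM normr_nat !ln2_normE ?mulf_neq0//.
rewrite lnM ?posrE ?mulr_gt0 ?normr_gt0 ?mulf_neq0//.
by rewrite ln2_normE ?mulf_neq0// ln_normM//; ring.
Qed.

(** The duplication formula for [lsin] integrates to the constancy of Cl2 (2y) - 2 Cl2 y + 2 Cl2 (pi
    - y), which is then compared at 0 and pi. *)
Lemma Cl2_pi : Cl2 pi = 0 :> R.
Proof.
pose H y := Cl2 (0 + 2 * y) + -2 * Cl2 y + 2 * Cl2 (pi + -1 * y) : R.
have cH : continuous H.
  apply: continuous1D; last first.
    exact/continuous1Z/continuous_Cl2_comp/continuous_affine.
  apply: continuous1D; last exact/continuous1Z/continuous_Cl2.
  exact/continuous_Cl2_comp/continuous_affine.
have dH (y : R) : sin (2 * y) != 0 -> is_derive y 1 H 0.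
  have -> : 2 * y = y * 2 by rewrite mulrC.
  move=> /sin_half_neq0; rewrite mulfK// => -[sy _].
  have [s c] := sin_half_neq0 sy.
  apply: (is_derive_eq (is_derive1D (is_derive1D
    (is_derive_Cl2_comp (is_derive_affine 0 2 y) _)
    (is_derive1Z (-2) (is_derive_Cl2 s)))
    (is_derive1Z 2 (is_derive_Cl2_comp (is_derive_affine pi (-1) y) _)))).
  - by rewrite (_ : (0 + 2 * y) / 2 = y)//; field.
  - by rewrite mulN1r sin_half_piB.
  - by rewrite add0r mulN1r lsin_double//; ring.
(* Here H pi = Cl2 (2 pi) - 2 Cl2 pi and H 0 = 2 Cl2 pi. The shift relation at -pi together with
   oddness gives Cl2 (2 pi) = 2 Cl2 pi, so H pi = 0. *)
have := derive0_off_sin2_eq0_cst cH dH pi.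
have := Cl2D2pi_cst (- pi).
rewrite /H !mulr0 !add0r !addr0 Cl2_0 mulr0 add0r mulN1r subrr.
rewrite Cl2_0 mulr0 addr0 Cl2N.
have -> : - pi + 2 * pi = pi :> R by ring.
by lra.
Qed.

Lemma Cl2_periodic : periodic (@Cl2 R) (2 * pi).
Proof.
move=> x; rewrite Cl2D2pi_cst.
have := Cl2D2pi_cst (- pi); rewrite Cl2N Cl2_pi oppr0 add0r.
by rewrite (_ : - pi + 2 * pi = pi :> R) ?Cl2_pi => [<-|]; [rewrite addr0|ring].
Qed.

(** * The identity on the principal branch of beta *)

Definition Cl2_comb (a b : R) : R :=
  Cl2 (pi - 2 * b) - 2 * Cl2 b - 2 * Cl2 (pi - b)
  + 2 * Cl2 a + 2 * Cl2 (pi - a)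
  + 2 * Cl2 (b - a) - 2 * Cl2 (pi - a - b).

Lemma Cl2_comb_atan (a : R) : Cl2_comb a (2 * atan (sin a)) = 0.
Proof.
pose b (x : R) := 2 * atan (sin x).
(* Existence of the derivative [d] suffices: in the final sum the logarithms cancel separately in
   the part multiplied by [d] and in the part free of [d]. *)
have db (x : R) : exists d, is_derive x 1 b d.
  have ds := is_derive1_comp_fun (is_derive_sin x) (is_derive1_atan (sin x)).
  by eexists; exact: is_derive1Z ds.
have cb : continuous b by move=> x; have [d /is_derive1_continuous] := db x.
(* The combination is rewritten with sums and scalar multiples only, the shape matched by the
   continuity and derivative rules. *)
pose H x : R := Cl2 (pi + -2 * b x) + -2 * Cl2 (b x) + -2 * Cl2 (pi + -1 * b x)
  + 2 * Cl2 x + 2 * Cl2 (pi + -1 * x)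
  + 2 * Cl2 (b x + -1 * x) + -2 * Cl2 (pi + -1 * x + -1 * b x).
have FH x : Cl2_comb x (b x) = H x by rewrite /Cl2_comb /H !mulNr !mul1r.
have cN : continuous (fun x : R => pi + -1 * x) by exact: continuous_affine.
have cNb : continuous (fun x : R => -1 * b x) by exact: continuous1Z.
have cst_c (c : R) : continuous (fun _ : R => c) by move=> x; exact: cvg_cst.
have cH : continuous H.
  do !apply: continuous1D.
  - apply/continuous_Cl2_comp/continuous1D => //; exact: continuous1Z.
  - exact/continuous1Z/continuous_Cl2_comp.
  - exact/continuous1Z/continuous_Cl2_comp/continuous1D.
  - exact/continuous1Z/continuous_Cl2.
  - exact/continuous1Z/continuous_Cl2_comp.
  - apply/continuous1Z/continuous_Cl2_comp/continuous1D => //.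
    by apply: continuous1Z => x; exact: cvg_id.
  - exact/continuous1Z/continuous_Cl2_comp/continuous1D.
suff dH (x : R) : sin (2 * x) != 0 -> is_derive x 1 H 0.
  (* At 0 the angle [b] is 0 and the combination collapses to - Cl2 pi = 0. *)
  rewrite -/(b a) FH (derive0_off_sin2_eq0_cst cH dH a) -FH /Cl2_comb /b.
  by rewrite sin0 atan0 !mulr0 !subr0 Cl2_0 Cl2_pi; ring.
move=> s2x.
have [sx cx] : sin x != 0 /\ cos x != 0.
  by have := sin_half_neq0 s2x; rewrite (_ : 2 * x / 2 = x)//; field.
have [p0 q0] := sin_half_neq0 sx.
set p := sin (x / 2) in p0; set q := cos (x / 2) in q0.
pose w := cos (b x / 2).
have w0 : w != 0.
  rewrite /w (_ : b x / 2 = atan (sin x)); last by rewrite /b; field.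
  by rewrite cos_atan invr_eq0 gt_eqF// sqrtr_gt0 ltr_wpDr// sqr_ge0.
(* From tan (b/2) = sin x = 2 p q. *)
have sb : sin (b x / 2) = 2 * (p * q) * w.
  have : tan (b x / 2) = sin x.
    by rewrite (_ : b x / 2 = atan (sin x)) ?atanK// /b; field.
  by rewrite /tan -sin_double => <-; rewrite divfK.
have pq : p ^+ 2 + q ^+ 2 = 1 by rewrite addrC cos2Dsin2.
have cxE : cos x = q ^+ 2 - p ^+ 2.
  by rewrite [in LHS](_ : x = x / 2 + x / 2) ?cosD -?expr2//; field.
have wE : w ^+ 2 + (2 * (p * q) * w) ^+ 2 = 1 by rewrite -sb cos2Dsin2.
(* The left side is cos b = w^2 (1 - sin^2 x) = w^2 cos^2 x, with 1 expanded as (p^2 + q^2)^2. *)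
have s1 : sin ((pi + -2 * b x) / 2) = w * w * (cos x * cos x).
  rewrite (_ : (pi + -2 * b x) / 2 = (pi - (b x + b x)) / 2); last by field.
  rewrite sin_half_piB (_ : (b x + b x) / 2 = b x / 2 + b x / 2); last by field.
  rewrite cosD -/w sb cxE.
  have e : 1 = (p ^+ 2 + q ^+ 2) ^+ 2 by rewrite pq expr1n.
  transitivity (w * w * (1 - (2 * (p * q)) ^+ 2)); first by ring.
  by rewrite [X in _ * (X - _)]e; ring.
have s2 : sin ((pi + -1 * b x) / 2) = w by rewrite mulN1r sin_half_piB.
have s3 : sin ((pi + -1 * x) / 2) = q by rewrite mulN1r sin_half_piB.
(* The subtraction formula leaves the factor 2 q^2 - 1 = cos x; for [s5] the factor is 1 - 2 p^2 =
   cos x. *)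
have s4 : sin ((b x + -1 * x) / 2) = w * p * cos x.
  rewrite (_ : (b x + -1 * x) / 2 = b x / 2 - x / 2); last by field.
  rewrite sinB sb -/w -/p -/q cxE.
  transitivity (w * p * (2 * q ^+ 2 - 1)); first by ring.
  by rewrite -[X in _ * (_ - X)]pq; ring.
have s5 : sin ((pi + -1 * x + -1 * b x) / 2) = w * q * cos x.
  rewrite (_ : (pi + _ + _) / 2 = (pi - (b x + x)) / 2); last by field.
  rewrite sin_half_piB (_ : (b x + x) / 2 = b x / 2 + x / 2); last by field.
  rewrite cosD sb -/w -/p -/q cxE.
  transitivity (w * q * (1 - 2 * p ^+ 2)); first by ring.
  by rewrite -[X in _ * (X - _)]pq; ring.
have [d dbx] := db x.
have dN := is_derive_affine pi (-1) x.
have dNb := is_derive1Z (-1) dbx.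
have dc := is_derive1_cst (pi : R) x.
apply: (is_derive_eq (is_derive1D (is_derive1D (is_derive1D (is_derive1D
  (is_derive1D (is_derive1D
  (is_derive_Cl2_comp (is_derive1D dc (is_derive1Z (-2) dbx)) _)
  (is_derive1Z (-2) (is_derive_Cl2_comp dbx _)))
  (is_derive1Z (-2) (is_derive_Cl2_comp (is_derive1D dc dNb) _)))
  (is_derive1Z 2 (is_derive_Cl2 p0)))
  (is_derive1Z 2 (is_derive_Cl2_comp dN _)))
  (is_derive1Z 2 (is_derive_Cl2_comp (is_derive1D dbx
     (is_derive1Z (-1) (is_derive1_id x))) _)))
  (is_derive1Z (-2) (is_derive_Cl2_comp (is_derive1D dN dNb) _)))).
- by rewrite s1 !mulf_neq0.
- by rewrite sb !mulf_neq0// pnatr_eq0.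
- by rewrite s2.
- by rewrite s3.
- by rewrite s4 !mulf_neq0.
- by rewrite s5 !mulf_neq0.
(* All terms become combinations of ln 2 and the logarithms of |p|, |q|, |w| and |cos x|, whose
   coefficients sum to 0. *)
rewrite (lsinE s1) (lsinE sb) (lsinE s2) (lsinE s3) (lsinE s4) (lsinE s5).
rewrite (@lsinE x p)// !ln2_normE ?mulf_neq0// ?pnatr_eq0//.
by rewrite !ln_normM ?mulf_neq0 ?pnatr_eq0// normr_nat; ring.
Qed.

(** * Reduction of an arbitrary beta to the principal branch *)

Lemma eq_atan_mod_pi (y t : R) : cos y != 0 -> tan y = t ->
  exists m : int, y = atan t + pi *~ m.
Proof.
move=> c0 tE; have pi0 := @pi_gt0 R.
(* Rounding y / pi to a nearest integer puts the remainder [z] in [-pi/2, pi/2[. *)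
pose m := Num.floor (y / pi + 2^-1); pose z := y - pi *~ m.
have yE : y = z + pi *~ m by rewrite subrK.
have tz : tan z = t.
  by rewrite -tE yE; apply/esym/periodic_int => ?; exact: tanDpi.
have cz : cos z != 0.
  rewrite -normr_eq0; apply: contraNN c0 => /eqP cz; rewrite -normr_eq0 yE.
  rewrite (@periodic_int _ _ (fun x => `|cos x|)) ?cz//.
  by move=> x; rewrite cosDpi normrN.
have /andP[zl zr] : - (pi / 2) <= z < pi / 2.
  have := floor_itv (y / pi + 2^-1); rewrite -/m intrD => /andP[ml mr].
  have e : y = y / pi * pi by rewrite divfK// gt_eqF.
  rewrite /z -mulrzr [in X in _ <= X]e [in X in X < _]e.
  by apply/andP; split; nra.
(* The left endpoint -pi/2 is excluded because cos z != 0, so [atan] inverts [tan] at [z]. *)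
exists m; rewrite -tz tanK// in_itv /= zr andbT lt_neqAle zl andbT.
by apply: contraNneq cz => <-; rewrite cosN cos_pihalf.
Qed.

End Clausen_identities.

Theorem theorem1 (R : realType) (alpha beta : R)
    (tan_def : cos (beta / 2) != 0)
    (Hab : sin alpha = tan (beta / 2)) :
  Cl2 (pi - 2 * beta) - 2 * Cl2 beta - 2 * Cl2 (pi - beta)
  + 2 * Cl2 alpha + 2 * Cl2 (pi - alpha)
  + 2 * Cl2 (beta - alpha) - 2 * Cl2 (pi - alpha - beta) = 0.
Proof.
have [m bE] := eq_atan_mod_pi tan_def (esym Hab).
have {}bE : beta = 2 * atan (sin alpha) + 2 * pi *~ m.
  by rewrite -mulrzr -mulrA mulrzr -mulrDr -bE; field.
rewrite -(Cl2_comb_atan alpha) /Cl2_comb; set b := 2 * atan _ in bE *.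
have per := periodic_int (@Cl2_periodic R).
have pm (k : int) : 2 * pi *~ k = 2 * pi * k%:~R :> R by rewrite mulrzr.
(* Each argument is its value at [b] plus an integer multiple of the period 2 pi; doubling beta
   doubles the number of periods. *)
have -> : pi - 2 * beta = pi - 2 * b + 2 * pi *~ (- 2 * m).
  by rewrite bE !pm intrM; ring.
have -> : pi - beta = pi - b + 2 * pi *~ (- m).
  by rewrite bE !pm mulrNz; ring.
have -> : beta - alpha = b - alpha + 2 * pi *~ m.
  by rewrite bE; ring.
have -> : pi - alpha - beta = pi - alpha - b + 2 * pi *~ (- m).
  by rewrite bE !pm mulrNz; ring.
by rewrite bE !per.
Qed.
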